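(* For all $n\in\mathbb N$ the following hold in the $q$-shuffle algebra $\mathbb V$: $$xC_n=(-1)^nq^{-n}\sum_{i=0}^n W_{-i}\star D_{n-i}=(-1)^nq^{n}\sum_{i=0}^n D_{n-i}\star W_{-i},$$ $$C_ny=(-1)^nq^{-n}\sum_{i=0}^n D_{n-i}\star W_{i+1}=(-1)^nq^{n}\sum_{i=0}^n W_{i+1}\star D_{n-i}.$$ Here $xC_n$ and $C_ny$ denote concatenation products in the free algebra.
   Context: Let $\mathbb F$ be a field and let $q\in\mathbb F$ be nonzero and not a root of unity. Let $[m]_q=(q^m-q^{-m})/(q-q^{-1})$. Let $\mathbb V$ be the free associative $\mathbb F$-algebra on noncommuting $x,y$, with basis the words (including $1$). Juxtaposition denotes concatenation. Set $\langle x,x\rangle=\langle y,y\rangle=2$ and $\langle x,y\rangle=\langle y,x\rangle=-2$. The $q$-shuffle product $\star$ is the bilinear product determined as follows: - $1\star v=v\star 1=v$; - for nontrivial words $u=u_1\cdots u_r$ and $v=v_1\cdots v_s$, $$u\star v=u_1((u_2\cdots u_r)\star v)+v_1(u\star(v_2\cdots v_s))q^{\langle u_1,v_1\rangle+\cdots+\langle u_r,v_1\rangle}.$$ This makes $\mathbb V$ an associative algebra, the $q$-shuffle algebra. For $k\in\mathbb N$: - $W_{-k}=xyx\cdots x$ is the alternating word of length $2k+1$ beginning and ending with $x$; - $W_{k+1}=yxy\cdots y$ is the alternating word of length $2k+1$ beginning and ending with $y$; - $\tilde G_k=xyxy\cdots xy$ is the word of length $2k$, with $\tilde G_0=1$.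 Define $D_0=1$ and, for $n\ge1$, define $D_n$ recursively by $\sum_{i=0}^n D_i\star\tilde G_{n-i}=0$. Let $\overline x=1$ and $\overline y=-1$. A word $v_1\cdots v_m$ is Catalan if $\overline v_1+\cdots+\overline v_i\ge0$ for $1\le i\le m-1$ and $\overline v_1+\cdots+\overline v_m=0$. For $n\in\mathbb N$, $$C_n=\sum v_1v_2\cdots v_{2n}\,[1]_q[1+\overline v_1]_q[1+\overline v_1+\overline v_2]_q\cdots[1+\overline v_1+\cdots+\overline v_{2n}]_q,$$ where the sum is over all Catalan words $v_1\cdots v_{2n}$ of length $2n$ (so $C_0=1$). *)

(* Defs.v *)
From HB Require Import structures.
From mathcomp Require Import all_boot all_order all_algebra.
From mathcomp Require Import finmap.
From mathcomp.multinomials Require Import monalg.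
Set Implicit Arguments. Unset Strict Implicit. Unset Printing Implicit Defensive.
Import Order.TTheory GRing.Theory Num.Theory.
Local Open Scope ring_scope.

Notation lx := true.
Notation ly := false.

(* The free associative algebra V on x,y, as the free F-module with basis
   the words (seq bool); the empty word [::] is the unit 1. *)
Definition V (F : fieldType) := {malg F[seq bool]}.

Section QShuffle.
Variables (F : fieldType) (q : F).

Definition wd (w : seq bool) : V F := << w >>.

Definition bilin (f : seq bool -> seq bool -> V F) (a b : V F) : V F :=
  \sum_(u <- msupp a) \sum_(v <- msupp b) (a@_u * b@_v) *: f u v.

Definition vcat (a b : V F) : V F := bilin (fun u v => wd (u ++ v)) a b.

Definition lcat (c : bool) (a : V F) : V F := vcat (wd [:: c]) a.

Definition pair (a b : bool) : int := if a == b then 2 else - 2.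

Definition expo (u : seq bool) (v1 : bool) : int := \sum_(a <- u) pair a v1.

Fixpoint qsh (u : seq bool) : seq bool -> V F :=
  match u with
  | [::] => wd
  | u1 :: u' =>
      fix qsh_u (v : seq bool) : V F :=
        match v with
        | [::] => wd u
        | v1 :: v' => lcat u1 (qsh u' v) + (q ^ (expo u v1)) *: lcat v1 (qsh_u v')
        end
  end.

Definition star (a b : V F) : V F := bilin qsh a b.

Definition Wm (k : nat) : seq bool := mkseq (fun i => ~~ odd i) k.*2.+1. (* W_{-k} = xyx...x *)
Definition Wp (k : nat) : seq bool := mkseq (fun i => odd i) k.*2.+1.    (* W_{k+1} = yxy...y *)
Definition Gt (k : nat) : seq bool := mkseq (fun i => ~~ odd i) k.*2.

Definition bar (c : bool) : int := if c then 1 else - 1.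

Definition psum (w : seq bool) (i : nat) : int := \sum_(c <- take i w) bar c.

Definition catalan (w : seq bool) : bool :=
  all (fun i => 0 <= psum w i) (iota 1 (size w).-1) && (psum w (size w) == 0).

Definition qint (m : int) : F := (q ^ m - q ^ (- m)) / (q - q^-1).

Definition cweight (w : seq bool) : F :=
  \prod_(i < (size w).+1) qint (1 + psum w i).

Definition Cn (n : nat) : V F :=
  \sum_(t : (n.*2).-tuple bool | catalan t) cweight t *: wd t.

End QShuffle.

(* Main.v *)
Require Import Defs.
From HB Require Import structures.
From mathcomp Require Import all_boot all_order all_algebra.
From mathcomp Require Import finmap ring zify.
From mathcomp.multinomials Require Import monalg.
Import Order.TTheory GRing.Theory Num.Theory.
Local Open Scope ring_scope.

Set Implicit Arguments.
Unset Strict Implicit.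

(** Let A_h(s) be the sum of the words that lead from height h down to 0 by
steps x = +1 and y = -1, where a step arriving at height k has the factor
[k + 1]_q and every x has the factor s. Removing the first letter gives
  A_h = [h] y A_(h-1) + s [h+2] x A_(h+1)   (plus 1 if h = 0),
and A_0 is the generating function of the C_n. Let Y_m be the alternating word
of length m ending in y, so that Y_(2k) is the word G~_k. The first letter of a
q-shuffle product is easily read off, which yields a recursion in the length N
for S_N^h = sum_n A_h^(n) * Y_(N-n). For s = -q induction on N gives
q^h S_N^(h+1) = S_N^h whenever N + h is odd, and then x A_0(-q t) * G~(t) is the
generating function of the W_(-n). For s = -1/q, the same induction applied to
the words A_h y gives q^(h+1) [h+2] S_N^(h+1) = [h+1] S_N^h and
A_0(-t/q) y * G~(t) as the generating function of the W_(n+1).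
Since G~ has weight 0, G~ *_q v = v *_(1/q) G~; the C_n being invariant under
q -> 1/q, this gives the products with G~ on the left. Finally the generating
function of the D_n is a two-sided inverse of that of the G~_n. *)

(** * Linear maps on the free module *)

Section LinearExtension.
Variable F : fieldType.
Implicit Types (a b : V F) (g : seq bool -> V F).

Definition lin g a : V F := \sum_(u <- msupp a) a@_u *: g u.

Lemma linEw (d : {fset seq bool}) g a : (msupp a `<=` d)%fset ->
  lin g a = \sum_(u <- d) a@_u *: g u.
Proof.
move=> sad; apply: big_fset_incl => // u _ ua.
by rewrite mcoeff_outdom // scale0r.
Qed.

Lemma lin_is_linear g c a b :
  lin g (c *: a + b) = c *: lin g a + lin g b.
Proof.
pose d := (msupp (c *: a + b) `|` (msupp a `|` msupp b))%fset.
rewrite (@linEw d) ?fsubsetUl // (@linEw d _ a); last first.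
  by rewrite fsubsetU // fsubsetUl orbT.
rewrite (@linEw d _ b); last by rewrite fsubsetU // fsubsetUr orbT.
rewrite scaler_sumr -big_split /=; apply: eq_bigr => u _.
by rewrite mcoeffD mcoeffZ scalerDl scalerA.
Qed.

HB.instance Definition _ g :=
  GRing.isLinear.Build F (V F) (V F) *:%R (lin g) (lin_is_linear g).

Lemma eq_lin g g' a : g =1 g' -> lin g a = lin g' a.
Proof. by move=> eg; apply: eq_bigr => u _; rewrite eg. Qed.

Lemma lin_wd g w : lin g (wd F w) = g w.
Proof.
by rewrite /lin /wd msuppU oner_eq0 big_seq_fset1 mcoeffUU scale1r.
Qed.

Lemma V_ind (P : V F -> Prop) : P 0 ->
  (forall c w a, P a -> P (c *: wd F w + a)) -> forall a, P a.
Proof.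
move=> P0 Pw a; rewrite (monalgE a); elim/big_rec: _ => // u x _ Px.
rewrite (_ : << _ *g u >> = a@_u *: wd F u); first exact: Pw.
by apply/malgP => w; rewrite mcoeffZ /wd !mcoeffU mulr_natr.
Qed.

Lemma bilinE f a b : bilin f a b = lin (fun u => lin (f u) b) a.
Proof.
apply: eq_bigr => u _; rewrite scaler_sumr; apply: eq_bigr => v _.
by rewrite scalerA.
Qed.

End LinearExtension.

(** * Partial sums and alternating words *)

Lemma psum0 w : psum w 0 = 0. Proof. by rewrite /psum take0 big_nil. Qed.

Lemma psum_cons c w i : psum (c :: w) i.+1 = bar c + psum w i.
Proof. by rewrite /psum /= big_cons. Qed.

(** Steps are 1 or -1 (0 past the end of [w]), so the first partial sum below 0 is exactly -1. *)
Lemma psum_neg w i : psum w i < 0 -> exists2 j, (j <= i)%N & psum w j = -1.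
Proof.
elim: i => [|i IH]; first by rewrite psum0.
have [/IH[j ji <-] _|] := ltP (psum w i) 0; first by exists j => //; apply: leqW.
move=> ge0 lt0; exists i.+1 => //; move: ge0 lt0.
have [iw|wi] := ltnP i (size w); last first.
  by rewrite /psum !take_oversize // ?(leqW wi) // => ge0; rewrite ltNge ge0.
rewrite {2 3}/psum (take_nth lx iw) big_rcons -/(psum w i) /bar /=.
by case: (nth _ _ _); lia.
Qed.

Lemma psum_count w : psum w (size w) = (count id w)%:Z - (count negb w)%:Z.
Proof.
elim: w => [|c w IH]; first by rewrite psum0.
by rewrite psum_cons IH /bar; case: c => /=; lia.
Qed.

Lemma count_x_balanced w n :
  size w = n.*2 -> psum w (size w) = 0 -> count id w = n.
Proof.
have : (count id w + count negb w = size w)%N by exact: count_predC.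
by rewrite psum_count => <-; lia.
Qed.

(** Built from the right end, so that removing the first letter stays in the family; [Gt], [Wp] and
    [Wm] number their letters from the left instead. *)
Fixpoint ends_y (m : nat) : seq bool :=
  if m is m'.+1 then odd m' :: ends_y m' else [::].

Fixpoint ends_x (m : nat) : seq bool :=
  if m is m'.+1 then ~~ odd m' :: ends_x m' else [::].

Lemma nth_ends_y m i : (i < m)%N -> nth ly (ends_y m) i = odd (m - i.+1).
Proof.
by elim: m i => // m IH [|i] im; rewrite /= ?subn1 // IH.
Qed.

Lemma nth_ends_x m i : (i < m)%N -> nth ly (ends_x m) i = ~~ odd (m - i.+1).
Proof.
by elim: m i => // m IH [|i] im; rewrite /= ?subn1 // IH.
Qed.

Lemma size_ends_y m : size (ends_y m) = m. Proof. by elim: m => //= m ->. Qed.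
Lemma size_ends_x m : size (ends_x m) = m. Proof. by elim: m => //= m ->. Qed.

Lemma Gt_ends_y k : Gt k = ends_y k.*2.
Proof.
apply: (@eq_from_nth _ ly); rewrite ?size_mkseq ?size_ends_y // => i ik.
by rewrite nth_mkseq // nth_ends_y // oddB // odd_double.
Qed.

Lemma Wp_ends_y k : Wp k = ends_y k.*2.+1.
Proof.
apply: (@eq_from_nth _ ly); rewrite ?size_mkseq ?size_ends_y // => i ik.
by rewrite nth_mkseq // nth_ends_y // oddB //= odd_double; case: odd.
Qed.

Lemma Wm_ends_x k : Wm k = ends_x k.*2.+1.
Proof.
apply: (@eq_from_nth _ ly); rewrite ?size_mkseq ?size_ends_x // => i ik.
by rewrite nth_mkseq // nth_ends_x // oddB //= odd_double; case: odd.
Qed.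

(** * q-integers and weights of Catalan words *)

Section CatalanWords.
Variables (F : fieldType) (q : F).
Hypotheses (q0 : q != 0) (q2 : q * q != 1).
Local Notation p := (q^-1).

Definition qnat n : F := qint q n%:Z.

Lemma qnat0 : qnat 0 = 0. Proof. by rewrite /qnat /qint oppr0 subrr mul0r. Qed.

Lemma qnat_Sl n : q * qnat n.+1 = qnat n + q ^+ n.+1.
Proof.
rewrite /qnat /qint -!exprnP -!exprnN -!exprVn !exprS.
by field; rewrite q0 subr_eq0.
Qed.

Lemma qnat_Sr n : qnat n.+1 = q * qnat n + p ^+ n.
Proof.
rewrite /qnat /qint -!exprnP -!exprnN -!exprVn !exprS.
by field; rewrite q0 subr_eq0.
Qed.

Lemma qnat_Sp n : qnat n.+1 = (qnat n + q ^+ n.+1) * p.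
Proof. by rewrite -qnat_Sl mulrAC mulfV ?mul1r. Qed.

(* A path going below 0 visits -1, where its weight has the factor [0]_q = 0. *)
Lemma catalan_weight w :
  (if catalan w then cweight q w else 0) =
  if psum w (size w) == 0 then cweight q w else 0.
Proof.
rewrite /catalan; case: (_ == 0); rewrite ?andbF // andbT.
case: allP => // /allP /allPn[i]; rewrite mem_iota -ltNge => /andP[_ iw].
move=> /psum_neg[j ji jw]; rewrite /cweight.
have jn : (j < (size w).+1)%N by apply: (leq_ltn_trans ji); lia.
by rewrite (bigD1 (Ordinal jn)) //= jw subrr /qint oppr0 subrr mul0r mul0r.
Qed.

(** The coefficient of [w] in A_h(s). For a step y at [h = 0] the height [h.-1] is junk, but the
    factor [qnat 0] is zero. *)
Fixpoint path_weight (s : F) h (w : seq bool) : F :=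
  match w with
  | [::] => (h == 0%N)%:R
  | c :: w' => if c then s * qnat h.+2 * path_weight s h.+1 w'
               else qnat h * path_weight s h.-1 w'
  end.

(** Heights are integers here, so a path may formally pass through -1. Unlike in [path_weight], the
    starting point contributes its own factor [h+1], as in the weights of C_n. *)
Definition height_weight (h : int) w : F :=
  (\prod_(i < (size w).+1) qint q (1 + h + psum w i)) *
  (h + psum w (size w) == 0)%:R.

Lemma height_weight_cons h c w :
  height_weight h (c :: w) = qint q (1 + h) * height_weight (h + bar c) w.
Proof.
rewrite /height_weight big_ord_recl psum0 addr0 -mulrA; congr (_ * _).
rewrite psum_cons [h + (_ + _)]addrA; congr (_ * _).
by apply: eq_bigr => i _; rewrite psum_cons !addrA.
Qed.

Lemma height_weightN1 w : height_weight (-1) w = 0.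
Proof.
by rewrite /height_weight big_ord_recl psum0 addr0 subrr /qint oppr0 subrr !mul0r.
Qed.

Lemma qnat_path_weight s h w :
  qnat h.+1 * path_weight s h w = s ^+ count id w * height_weight h%:Z w.
Proof.
elim: w h => [|c w IH] h.
  rewrite /height_weight big_ord1 psum0 !addr0 expr0 mul1r /qnat.
  by rewrite -[h.+1]add1n PoszD eqz_nat.
rewrite height_weight_cons -PoszD add1n -/(qnat h.+1).
case: c => /=.
  rewrite exprS -[s * _ * _]mulrA IH -[h.+1]addn1 PoszD; ring.
rewrite add0n; case: h => [|h]; first by rewrite qnat0 mul0r height_weightN1 !mulr0.
by rewrite IH -[h.+1]addn1 PoszD addrK mulrCA.
Qed.

Lemma path_weight0 s w :
  path_weight s 0 w = s ^+ count id w * (if catalan w then cweight q w else 0).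
Proof.
have := qnat_path_weight s 0 w.
rewrite qnat_Sr // qnat0 mulr0 expr0 add0r mul1r => ->; rewrite catalan_weight.
by congr (_ * _); rewrite /height_weight add0r mulr_natr mulrb; case: eqP.
Qed.

End CatalanWords.

(* [M] is [V F] with its concrete construction hidden: [e] is the basis of words
   and [L g] the linear map with values [g] on it. *)
Section FreeModuleOnWords.
Variables (F : fieldType) (M : lmodType F) (e : seq bool -> M).
Variable L : (seq bool -> M) -> {linear M -> M}.
Hypothesis L_e : forall g w, L g (e w) = g w.
Hypothesis e_ind : forall P : M -> Prop, P 0 ->
  (forall c w a, P a -> P (c *: e w + a)) -> forall a, P a.

Definition prepend (c : bool) : {linear M -> M} := L (fun w => e (c :: w)).

Lemma prepend_e c w : prepend c (e w) = e (c :: w). Proof. exact: L_e. Qed.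

(** * The q-shuffle product: bilinearity and associativity *)

Section Product.
Variable q : F.

Fixpoint shuffle_words (u : seq bool) : seq bool -> M :=
  match u with
  | [::] => e
  | u1 :: u' =>
      fix shuffle_u (v : seq bool) : M :=
        match v with
        | [::] => e u
        | v1 :: v' => prepend u1 (shuffle_words u' v) +
                      q ^ expo u v1 *: prepend v1 (shuffle_u v')
        end
  end.

Definition shuffle (a b : M) : M := L (fun u => L (shuffle_words u) b) a.
Local Notation "a ** b" := (shuffle a b) (at level 40, left associativity).
Implicit Types (a b : M) (u v w : seq bool).

(* The power of [q] that appears when a letter [c] moves in front of a word. *)
Definition twist c : {linear M -> M} := L (fun w => q ^ expo w c *: e w).

Lemma shuffle0l b : 0 ** b = 0. Proof. exact: linear0. Qed.
Lemma shuffleDl b a a' : (a + a') ** b = a ** b + a' ** b.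
Proof. exact: linearD. Qed.
Lemma shuffleZl b c a : (c *: a) ** b = c *: (a ** b).
Proof. exact: linearZ_LR. Qed.
Lemma shuffle_suml b I (r : seq I) P (f : I -> M) :
  (\sum_(i <- r | P i) f i) ** b = \sum_(i <- r | P i) f i ** b.
Proof. exact: linear_sum. Qed.

Lemma shuffle_linr a c b b' : a ** (c *: b + b') = c *: (a ** b) + a ** b'.
Proof.
elim/e_ind: a => [|k w a]; first by rewrite !shuffle0l scaler0 addr0.
rewrite !(shuffleDl, shuffleZl) => ->; rewrite /shuffle !L_e linearP !scalerDr !scalerA.
by rewrite (mulrC c) addrACA.
Qed.

HB.instance Definition _ a :=
  GRing.isLinear.Build F M M *:%R (shuffle a) (shuffle_linr a).

Lemma shuffle0r a : a ** 0 = 0. Proof. exact: linear0. Qed.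
Lemma shuffleDr a b b' : a ** (b + b') = a ** b + a ** b'.
Proof. exact: linearD. Qed.
Lemma shuffleZr a c b : a ** (c *: b) = c *: (a ** b).
Proof. exact: linearZ_LR. Qed.
Lemma shuffle_sumr a I (r : seq I) P (f : I -> M) :
  a ** (\sum_(i <- r | P i) f i) = \sum_(i <- r | P i) a ** f i.
Proof. exact: linear_sum. Qed.

Definition shuffleE := (shuffleDl, shuffleZl, shuffleDr, shuffleZr, shuffle0l, shuffle0r).

Lemma prependZ c k a : prepend c (k *: a) = k *: prepend c a.
Proof. exact: linearZ_LR. Qed.
Lemma twistZ c k a : twist c (k *: a) = k *: twist c a. Proof. exact: linearZ_LR. Qed.
Definition linE := (prependZ, twistZ,
  fun c => linearD (prepend c), fun c => linearD (twist c),
  fun c => linear0 (prepend c), fun c => linear0 (twist c)).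

Lemma shuffle_e u v : e u ** e v = shuffle_words u v.
Proof. by rewrite /shuffle !L_e. Qed.

Lemma twist_e c w : twist c (e w) = q ^ expo w c *: e w.
Proof. exact: L_e. Qed.

Lemma shuffle_words_nil u : shuffle_words u [::] = e u. Proof. by case: u. Qed.

Lemma shuffle_words_cons c u d v : shuffle_words (c :: u) (d :: v) =
  prepend c (shuffle_words u (d :: v)) +
  q ^ expo (c :: u) d *: prepend d (shuffle_words (c :: u) v).
Proof. by []. Qed.

Lemma shuffle1l a : e [::] ** a = a.
Proof.
elim/e_ind: a => [|k w a IH]; first by rewrite shuffle0r.
by rewrite !shuffleE IH shuffle_e.
Qed.

Lemma shuffle1r a : a ** e [::] = a.
Proof.
elim/e_ind: a => [|k w a IH]; first by rewrite shuffle0l.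
by rewrite !shuffleE IH shuffle_e shuffle_words_nil.
Qed.

(** The defining recursion extended to linear combinations; [twist] supplies the powers of q, which
    vary from word to word. *)
Lemma shuffle_prepend c a d b : prepend c a ** prepend d b =
  prepend c (a ** prepend d b) + prepend d (twist d (prepend c a) ** b).
Proof.
elim/e_ind: a => [|k u a IHa]; first by rewrite !(linE, shuffleE) addr0.
rewrite !(linE, shuffleE) IHa addrACA; congr (_ + _).
rewrite -scalerDr; congr (_ *: _); elim/e_ind: b {IHa} => [|k' v b IHb].
  by rewrite !(linE, shuffleE) addr0.
rewrite !(linE, shuffleE) IHb addrACA -scalerDr; congr (_ *: _ + _).
by rewrite !prepend_e twist_e !(linE, shuffleE) !shuffle_e shuffle_words_cons.
Qed.

Hypothesis q0 : q != 0.

Lemma expo_cons c w d : expo (c :: w) d = pair c d + expo w d.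
Proof. by rewrite /expo big_cons. Qed.

Lemma expo_nil d : expo [::] d = 0.
Proof. by rewrite /expo big_nil. Qed.

Lemma twist_prepend d c a : twist d (prepend c a) = q ^ pair c d *: prepend c (twist d a).
Proof.
elim/e_ind: a => [|k u a IHa]; first by rewrite !linE scaler0.
rewrite !linE IHa scalerDr !scalerA mulrC -scalerA; congr (_ *: _ + _).
by rewrite prepend_e !twist_e !linE prepend_e scalerA expo_cons expfzDr.
Qed.

(** [expo] depends only on the letters of a word, and every word in the product has exactly the
    letters of [u] and [v]. *)
Lemma twist_shuffle_words d u v :
  twist d (shuffle_words u v) = (q ^ expo u d * q ^ expo v d) *: shuffle_words u v.
Proof.
elim: u v => [|c u IHu] v.
  by rewrite twist_e expo_nil expr0z mul1r.
elim: v => [|k v IHv]; first by rewrite twist_e expo_nil expr0z mulr1.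
rewrite shuffle_words_cons !linE !twist_prepend IHu IHv !linE scalerDr.
rewrite !scalerA; congr (_ *: _ + _ *: _); rewrite !expo_cons !expfzDr //; ring.
Qed.

(** Triple induction. Both sides split by whether the first letter comes from the first, second or
    third word; each part is covered by the induction hypothesis for that word. *)
Lemma shuffle_assoc_e u v w : shuffle_words u v ** e w = e u ** shuffle_words v w.
Proof.
elim: u v w => [|c u IHu] v w; first by rewrite shuffle1l shuffle_e.
elim: v w => [|d v IHv] w; first by rewrite shuffle_words_nil shuffle_e.
elim: w => [|k w IHw]; first by rewrite shuffle_words_nil shuffle1r shuffle_e.
have split_l x a : prepend x a ** e (k :: w) =
  prepend x (a ** e (k :: w)) + prepend k (twist k (prepend x a) ** e w).
  by rewrite -prepend_e shuffle_prepend.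
have split_r x b : e (c :: u) ** prepend x b =
  prepend c (e u ** prepend x b) + q ^ expo (c :: u) x *: prepend x (e (c :: u) ** b).
  by rewrite -(prepend_e c u) shuffle_prepend prepend_e twist_e shuffleZl linE.
(* Terms starting with [k]: it passes the whole product of the first two words, so the two summands
   of that product recombine and [IHw] applies. *)
have tail : prepend k (twist k (prepend c (shuffle_words u (d :: v))) ** e w) +
    q ^ expo (c :: u) d *:
      prepend k (twist k (prepend d (shuffle_words (c :: u) v)) ** e w) =
  (q ^ expo (c :: u) k * q ^ expo (d :: v) k) *:
    prepend k (e (c :: u) ** shuffle_words (d :: v) w).
  by rewrite -IHw -[RHS]prependZ -[in RHS]shuffleZl -twist_shuffle_words
    shuffle_words_cons !(linE, shuffleE).
rewrite shuffle_words_cons shuffleDl shuffleZl !split_l scalerDr addrACA tail IHu IHv.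
rewrite [shuffle_words (d :: v) _]shuffle_words_cons !shuffleDr !shuffleZr.
rewrite (split_r k) (split_r d).
rewrite !linE scalerDr scalerA mulrC -!addrA; congr (_ + _).
by rewrite addrCA.
Qed.

Lemma shuffle_assoc a b c : (a ** b) ** c = a ** (b ** c).
Proof.
elim/e_ind: a => [|k u a IHa]; first by rewrite !shuffleE.
rewrite !shuffleE IHa; congr (_ *: _ + _).
elim/e_ind: b {IHa} => [|k' v b IHb]; first by rewrite !shuffleE.
rewrite !shuffleE IHb; congr (_ *: _ + _).
elim/e_ind: c {IHb} => [|k'' w c IHc]; first by rewrite !shuffleE.
by rewrite !shuffleE IHc !shuffle_e shuffle_assoc_e.
Qed.

(** * Convolution with alternating words *)

Local Notation p := (q^-1).

(* [N] counts letters: [A n] is meant to consist of words of length [n] (up to a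
   constant shift). *)
Definition alt_conv (A : nat -> M) N := \sum_(n < N.+1) A n ** e (ends_y (N - n)).

Lemma shuffle_letters a b (x y : F) l w :
  let c := x *: prepend ly a + y *: prepend lx b in
  c ** e (l :: w) = x *: prepend ly (a ** e (l :: w)) + y *: prepend lx (b ** e (l :: w))
    + prepend l (twist l c ** e w).
Proof.
move=> c; rewrite /c !(linE, shuffleE) -prepend_e !shuffle_prepend !prepend_e !scalerDr.
by rewrite addrACA.
Qed.

(** A first letter comes from [A] (giving [P] and [Q]) or from the alternating word. By the parity
    condition the latter is [l] in every nonzero term, so these parts add up to the convolution of
    [A] again. [Z] is what the term [n = 0] adds, since [A 0] has no recursion. *)
Lemma alt_conv_rec (A P Q : nat -> M) (x y k : F) (l : bool) Z N :
  (forall n, A n.+1 = x *: prepend ly (P n) + y *: prepend lx (Q n)) ->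
  (forall n, (n <= N)%N -> odd (N - n) != l -> A n = 0) ->
  (forall n, twist l (A n) = k *: A n) ->
  A 0%N ** e (ends_y N.+1) = Z + k *: prepend l (A 0%N ** e (ends_y N)) ->
  alt_conv A N.+1 =
    Z + x *: prepend ly (alt_conv P N) + y *: prepend lx (alt_conv Q N) +
    k *: prepend l (alt_conv A N).
Proof.
move=> A_rec A_par A_kop A0.
have step (i : 'I_N) : A i.+1 ** e (ends_y (N - i)) =
    x *: prepend ly (P i ** e (ends_y (N - i))) +
    y *: prepend lx (Q i ** e (ends_y (N - i))) +
    k *: prepend l (A i.+1 ** e (ends_y (N - i.+1))).
  rewrite -(subnSK (ltn_ord i)) /= [in LHS]A_rec shuffle_letters -A_rec.
  congr (_ + _); have [->|nl] := eqVneq (odd (N - i.+1)) l.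
    by rewrite A_kop shuffleZl linE.
  by rewrite (A_par _ _ nl) // !(linE, shuffleE) scaler0.
rewrite /alt_conv big_ord_recl subn0 A0.
rewrite (eq_bigr (fun i : 'I_N.+1 => A i.+1 ** e (ends_y (N - i)))) //.
rewrite [in LHS]big_ord_recr /= subnn shuffle1r A_rec (eq_bigr _ (fun i _ => step i)).
rewrite !big_split /= -!scaler_sumr -!linear_sum.
rewrite [in RHS]big_ord_recr [\sum_(n < N.+1) Q n ** _]big_ord_recr /=.
rewrite [\sum_(n < N.+1) A n ** _]big_ord_recl /= subnn subn0 !shuffle1r.
rewrite !linearD /=.
(* Of the seven summands, 1 is [Z], 3 and 6 belong to [P], 4 and 7 to [Q], 2 and 5 to [A]. *)
by rewrite [LHS](AC (2*(3*2)) ((1*(3*6))*(4*7)*(2*5))).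
Qed.

Hypothesis q2 : q * q != 1.

(** * Path sums A_h(s) and their convolutions *)

Section CatalanFamily.
Variable s : F.

(* The component of length [n] of A_h(s). At [h = 0] the junk value [h.-1 = 0] is
   harmless because [qnat q 0 = 0]. *)
Fixpoint path_sum n h : M :=
  if n is n'.+1 then
    qnat q h *: prepend ly (path_sum n' h.-1) +
    (s * qnat q h.+2) *: prepend lx (path_sum n' h.+1)
  else (h == 0)%:R *: e [::].

(** A path from [h] to 0 has length congruent to [h] modulo 2. *)
Lemma path_sum_odd n h : odd (n + h) -> path_sum n h = 0.
Proof.
elim: n h => [|n IH] [|h] //= par; first by rewrite scale0r.
  by rewrite qnat0 scale0r add0r IH ?linear0 ?scaler0 // addn1 -(addn0 n).
rewrite !IH ?linear0 ?scaler0 ?addr0 //; move: par; rewrite !addnS //=.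
by rewrite negbK.
Qed.

(** Words leading from [h] to 0 have [h] more letters y than x, so moving x in front of one gives
    q^(-2h), and moving y gives q^(2h). *)
Definition twist_eigen d h := if d then p ^+ h * p ^+ h else q ^+ h * q ^+ h.

Lemma exprz_pair c d : q ^ pair c d = if c == d then q * q else p * p.
Proof.
rewrite /pair; case: (c == d); first by rewrite -exprnP expr2.
by rewrite -exprnN -exprVn expr2.
Qed.

Lemma twist_path_sum d n h : twist d (path_sum n h) = twist_eigen d h *: path_sum n h.
Proof.
elim: n h => [|n IH] h.
  rewrite /= twistZ twist_e expo_nil expr0z scale1r; case: h => [|h].
    by rewrite /twist_eigen !expr0 mulr1 if_same scale1r.
  by rewrite scale0r scaler0.
rewrite [path_sum]lock /= -lock linearD !twistZ !twist_prepend !IH !linearZ /=.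
rewrite scalerDr !scalerA.
congr (_ *: _ + _ *: _).
  case: h => [|h]; first by rewrite qnat0 !mulr0.
  by rewrite exprz_pair /twist_eigen !exprS; case: d {IH} => /=; field.
by rewrite exprz_pair /twist_eigen !exprS; case: d {IH} => /=; field.
Qed.

Let S N h := alt_conv (path_sum^~ h) N.

(** In nonzero terms [n] and [h] have equal parity, so a nonempty alternating factor always starts
    with [odd (N + h)]. *)
Lemma alt_conv_path_rec N h : S N.+1 h =
  qnat q h *: prepend ly (S N h.-1) + (s * qnat q h.+2) *: prepend lx (S N h.+1) +
  twist_eigen (odd (N + h)) h *: prepend (odd (N + h)) (S N h).
Proof.
rewrite /S (alt_conv_rec (P := path_sum^~ h.-1) (Q := path_sum^~ h.+1) (Z := 0)
  (x := qnat q h) (y := s * qnat q h.+2) (k := twist_eigen (odd (N + h)) h)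
  (l := odd (N + h))).
- by rewrite add0r.
- by [].
- move=> n nN par; apply: path_sum_odd; move: par; rewrite oddB // !oddD.
  by case: (odd N); case: (odd n); case: (odd h).
- by move=> n; rewrite twist_path_sum.
case: h => [|h]; last by rewrite /= !scale0r !shuffle0l !(linE, scaler0) addr0.
by rewrite /= !scale1r !shuffle1l prepend_e addn0 add0r /twist_eigen !expr0
  mulr1 if_same scale1r.
Qed.

(** * The case s = -q: products of x A_0 *)

Section LeftLetter.
Hypothesis s_def : s = - q.

(** The induction hypothesis at [h.-1] and [h.+1] turns both sides into combinations of y [S N h]
    and x [S N h.+1], whose coefficients are then compared. *)
Lemma alt_conv_path_shift N h : odd (N + h) -> q ^+ h *: S N h.+1 = S N h.
Proof.
elim: N h => [|N IH] h par.
  rewrite /S /alt_conv !big_ord1 /=; case: h par => //= h _.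
  by rewrite !scale0r !shuffle0l scaler0.
have y_part : qnat q h *: S N h.-1 = (qnat q h * q ^+ h * p) *: S N h.
  case: h par => [|h] par; first by rewrite qnat0 !mul0r !scale0r.
  rewrite /= -IH ?scalerA; first by congr (_ *: _); rewrite exprS; field.
  by move: par; rewrite addnS addSn /= negbK.
have par' : odd (N + h) = false by move: par; rewrite addSn /= => /negbTE.
have x_part : S N h.+2 = (p ^+ h * p) *: S N h.+1.
  rewrite -(IH h.+1) ?addnS ?par' // scalerA exprS.
  rewrite -[LHS]scale1r; congr (_ *: _); rewrite exprVn; field.
  by rewrite q0 expf_neq0.
rewrite !alt_conv_path_rec addnS /= par' /twist_eigen /= x_part.
rewrite -[qnat q h *: _]prependZ y_part.
rewrite !(linE, scalerDr, scalerA).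
(* The y coefficients do not involve [s]; equality of the x coefficients amounts to s = -q. *)
rewrite -addrA -scalerDl addrAC -scalerDl; congr (_ *: _ + _ *: _).
  by rewrite (qnat_Sp q0 q2) exprS; field.
rewrite (qnat_Sr q0 q2 h.+2) s_def !exprS exprVn; field.
by rewrite q0 expf_neq0.
Qed.

Let T N := alt_conv (fun n => prepend lx (path_sum n 0)) N.

Lemma alt_conv_prepend_rec N :
  T N.+1 = prepend lx (S N.+1 0) + q ^ pair lx (odd N) *: prepend (odd N) (T N).
Proof.
(* The left factors all start with [lx], so [P] is 0 and [Q] is A_0 shifted by one; the skipped
   component [n = 0] of A_0 enters through [Z]. *)
rewrite /T (alt_conv_rec (P := fun=> 0) (Q := fun n => path_sum n.+1 0) (x := 0) (y := 1)
  (Z := prepend lx (e (ends_y N.+1))) (k := q ^ pair lx (odd N)) (l := odd N)).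
- rewrite scale0r addr0 scale1r -linearD /S [in RHS]/alt_conv big_ord_recl subn0.
  by rewrite [path_sum 0 0]/= scale1r shuffle1l.
- by move=> n; rewrite scale0r scale1r add0r.
- move=> n nN par; rewrite path_sum_odd ?linear0 // addn0; move: par.
  by rewrite oddB //; case: (odd N); case: (odd n).
- by move=> n; rewrite twist_prepend twist_path_sum /twist_eigen !expr0 mulr1
    if_same scale1r.
rewrite /= !scale1r !prepend_e -(prepend_e (odd N)) -(prepend_e lx [::]).
rewrite shuffle_prepend shuffle1l.
by rewrite twist_prepend twist_e expo_nil expr0z scale1r shuffleZl linE !prepend_e.
Qed.

(** Two steps of the recursion, from [N] to [N.+2]. By [alt_conv_path_shift] the terms starting with
    xx are multiples of xx [S N.+1 0], with total coefficient s[2] + 1 + q^2 = 0; what remains is xy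
    [T N]. *)
Lemma alt_conv_prepend N : ~~ odd N -> T N = e (ends_x N.+1).
Proof.
elim/ltn_ind: N => -[|[|N]] IH //=.
  by rewrite /T /alt_conv big_ord1 /= shuffle1r scale1r prepend_e.
rewrite negbK => parN; have par : odd N.+1 by rewrite /= parN.
rewrite !alt_conv_prepend_rec (alt_conv_path_rec N.+1) qnat0 scale0r add0r addn0 par.
have := alt_conv_path_shift (h := 0) (N := N.+1); rewrite expr0 scale1r addn0.
move=> -> //; rewrite /twist_eigen !expr0 mulr1 -scalerDl IH //.
rewrite (negbTE parN) !exprz_pair /= !(linE, scalerDr) !scalerA addrA -scalerDl.
have -> : s * qnat q 2 + 1 + q * q = 0.
  by rewrite s_def !(qnat_Sr q0 q2) qnat0 expr0; field.
rewrite scale0r add0r !prepend_e (_ : q * q * (p * p) = 1) ?scale1r //; last by field.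
by rewrite parN.
Qed.

End LeftLetter.

(** * The case s = -q^-1: products of A_h y *)

Section RightLetter.
Hypothesis s_def : s = - p.

Definition append_y : {linear M -> M} := L (fun w => e (w ++ [:: ly])).

Lemma append_y_prepend c a : append_y (prepend c a) = prepend c (append_y a).
Proof.
elim/e_ind: a => [|k w a IH]; first by rewrite !linear0.
by rewrite !linearP IH !prepend_e !L_e.
Qed.

Lemma twist_append_y d a : twist d (append_y a) = q ^ pair ly d *: append_y (twist d a).
Proof.
elim/e_ind: a => [|k w a IH]; first by rewrite !linear0.
rewrite !linearP IH /=; congr (_ *: _ + _).
rewrite twist_e (linearZ_LR append_y) !L_e !scalerA; congr (_ *: _).
by rewrite /expo big_cat big_seq1 /= expfzDr // mulrC.
Qed.

Let B h n := append_y (path_sum n h).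
Let R N h := alt_conv (B h) N.

(** The appended y changes the eigenvalue of [twist], and the component [n = 0] at [h = 0] is the
    word y instead of the empty word, which accounts for the additional first summand. *)
Lemma alt_conv_append_rec N h : R N.+1 h =
  (h == 0)%:R *: prepend ly (e (ends_y N.+1)) +
  qnat q h *: prepend ly (R N h.-1) + (s * qnat q h.+2) *: prepend lx (R N h.+1) +
  (q ^ pair ly (odd (N + h)) * twist_eigen (odd (N + h)) h) *:
    prepend (odd (N + h)) (R N h).
Proof.
rewrite /R (alt_conv_rec (P := B h.-1) (Q := B h.+1)
  (Z := (h == 0)%:R *: prepend ly (e (ends_y N.+1)))
  (x := qnat q h) (y := s * qnat q h.+2) (l := odd (N + h))
  (k := q ^ pair ly (odd (N + h)) * twist_eigen (odd (N + h)) h)) //.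
- by move=> n; rewrite /B /= linearD !(linearZ_LR append_y) !append_y_prepend.
- move=> n nN par; rewrite /B path_sum_odd ?linear0 //; move: par; rewrite oddB // !oddD.
  by case: (odd N); case: (odd n); case: (odd h).
- by move=> n; rewrite twist_append_y twist_path_sum (linearZ_LR append_y) scalerA.
case: h => [|h]; last by rewrite /B /= !scale0r linear0 !shuffle0l linear0 scaler0 addr0.
rewrite /B /= !scale1r addn0 L_e /twist_eigen !expr0 mulr1 if_same mulr1.
rewrite -(prepend_e (odd N)) -(prepend_e ly [::]) shuffle_prepend shuffle1l.
by rewrite twist_prepend twist_e expo_nil expr0z scale1r shuffleZl linE !prepend_e.
Qed.

(** Joint induction: the relation at [h = 0] needs the known value of [R N 0] in place of a term of
    height -1, and that value in turn comes from the relation at [h = 0]. *)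
Lemma alt_conv_append N :
  (forall h, odd (N + h) ->
    (q ^+ h.+1 * qnat q h.+2) *: R N h.+1 = qnat q h.+1 *: R N h) /\
  (~~ odd N -> R N 0 = e (ends_y N.+1)).
Proof.
elim: N => [|N [IH1 IH2]].
  rewrite /R /alt_conv; split=> [h par|_].
    rewrite !big_ord1 /B /=; case: h par => //= h _.
    by rewrite !scale0r linear0 !shuffle0l !scaler0.
  by rewrite big_ord1 /B /= scale1r shuffle1r L_e.
split=> [h|]; last first.
  rewrite /= negbK alt_conv_append_rec qnat0 scale0r addr0 scale1r addn0 => par.
  rewrite par -[RHS]addr0 prepend_e -addrA; congr (_ + _).
    by rewrite /= par.
  have := IH1 0; rewrite addn0 => /(_ par); rewrite (_ : qnat q 1 = 1); last first.
    by rewrite (qnat_Sr q0 q2) qnat0 mulr0 expr0 add0r.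
  (* The two terms starting with x are both multiples of x [R N 1] and cancel since s = -q^-1. *)
  rewrite scale1r => <-; rewrite linE scalerA -scalerDl exprz_pair /twist_eigen /= s_def.
  by rewrite (_ : _ + _ = 0) ?scale0r //; rewrite expr1 expr0; field.
rewrite addSn /= => par.
have par1 : odd (N + h.+1) by rewrite addnS.
have y_part : (h == 0)%:R *: prepend ly (e (ends_y N.+1)) +
    qnat q h *: prepend ly (R N h.-1) =
    (q ^+ h * qnat q h.+1) *: prepend ly (R N h).
  case: h par par1 => [|h] par par1.
    rewrite qnat0 scale0r addr0 (qnat_Sr q0 q2) qnat0 expr0 mulr0 add0r mulr1 IH2 //.
    by move: par; rewrite addn0.
  rewrite scale0r add0r -prependZ -IH1 ?prependZ //.
  by move: par; rewrite addnS /= negbK.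
have x_part : qnat q h.+3 *: R N h.+2 = (p ^+ h.+2 * qnat q h.+2) *: R N h.+1.
  rewrite -[in RHS]scalerA -(IH1 h.+1) // !scalerA; congr (_ *: _).
  by rewrite exprVn; field; rewrite expf_neq0.
rewrite !alt_conv_append_rec addnS /= (negbTE par) y_part scale0r add0r.
have := congr1 (fun z => s *: prepend lx z) x_part; 
rewrite !prependZ !scalerA => ->.
rewrite /twist_eigen !exprz_pair /= !(linE, scalerDr, scalerA).
rewrite -addrA -scalerDl addrAC -scalerDl; congr (_ *: _ + _ *: _).
  by rewrite (qnat_Sp q0 q2 h.+1) !exprS; field.
rewrite (qnat_Sr q0 q2 h.+1) s_def !exprS exprVn; field.
by rewrite q0 expf_neq0.
Qed.

End RightLetter.

End CatalanFamily.

(** * Convolution of sequences *)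

Definition convol (A B : nat -> M) n := \sum_(i < n.+1) A i ** B (n - i)%N.

Lemma convol_assoc (A B C : nat -> M) n :
  convol (convol A B) C n = convol A (convol B C) n.
Proof.
rewrite /convol.
transitivity (\sum_(i < n.+1) \sum_(j < n.+1 | (j < i.+1)%N)
    A j ** (B (i - j)%N ** C (n - i)%N)).
  apply: eq_bigr => i _; rewrite shuffle_suml.
  rewrite -(big_ord_widen n.+1 (fun j => A j ** (B (i - j)%N ** C (n - i)%N))) //.
  by apply: eq_bigr => j _; rewrite shuffle_assoc.
rewrite (exchange_big_dep xpredT) //=; apply: eq_bigr => j _.
rewrite shuffle_sumr -(big_geq_mkord j n.+1 xpredT
  (fun i => A j ** (B (i - j)%N ** C (n - i)%N))).
rewrite -{1}[val j]add0n big_addn (subSn (leq_ord j)) big_mkord.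
by apply: eq_bigr => k _; rewrite addnK subnDA subnAC.
Qed.

Lemma eq_convol (A A' B B' : nat -> M) n :
  A =1 A' -> B =1 B' -> convol A B n = convol A' B' n.
Proof. by move=> eA eB; apply: eq_bigr => i _; rewrite eA eB. Qed.

Definition delta (n : nat) : M := (n == 0)%:R *: e [::].

Lemma convol_delta_l (A : nat -> M) n : convol delta A n = A n.
Proof.
rewrite /convol big_ord_recl big1 => [|i _].
  by rewrite addr0 subn0 /delta scale1r shuffle1l.
by rewrite /delta scale0r shuffle0l.
Qed.

Lemma convol_delta_r (A : nat -> M) n : convol A delta n = A n.
Proof.
rewrite /convol big_ord_recr big1 => [|i _].
  by rewrite /= add0r /delta subnn scale1r shuffle1r.
by rewrite /delta /= subn_eq0 leqNgt ltn_ord scale0r shuffle0r.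
Qed.

End Product.

(** * Exchanging the factors while inverting q *)

Lemma expo_ends_y c m : expo (ends_y m) c = if odd m then pair ly c else 0.
Proof.
elim: m => [|m IH]; first by rewrite expo_nil.
by rewrite expo_cons IH /=; case: (odd m); case: c {IH}.
Qed.

Definition pairing u v : int := \sum_(b <- v) expo u b.

Lemma pairing_cons_l c u v : pairing (c :: u) v = pairing u v + expo v c.
Proof.
rewrite /pairing /expo -big_split; apply: eq_bigr => b _ /=.
by rewrite big_cons addrC /pair eq_sym.
Qed.

Lemma pairing_cons_r d u v : pairing u (d :: v) = expo u d + pairing u v.
Proof. by rewrite /pairing big_cons. Qed.

(** In each interleaving, a letter of [v] either passes a given letter of [u] or is passed by it. So
    the exponent in one order is [pairing u v] minus that in the other. *)
Lemma shuffle_words_flip q u v : q != 0 ->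
  shuffle_words q u v = q ^ pairing u v *: shuffle_words q^-1 v u.
Proof.
move=> q0; elim: u v => [|c u IHu] v.
  rewrite shuffle_words_nil /pairing big1 ?expr0z ?scale1r // => b _; exact: expo_nil.
elim: v => [|d v IHv]; first by rewrite /pairing big_nil expr0z scale1r.
rewrite !shuffle_words_cons IHu IHv !linearZ /= scalerDr !scalerA addrC.
congr (_ *: _ + _ *: _).
  by rewrite pairing_cons_r mulrC expfzDr.
by rewrite pairing_cons_l exprz_inv -expfzDr // addrK.
Qed.

Lemma shuffle_flip q a v : q != 0 -> (forall c, expo v c = 0) ->
  shuffle q (e v) a = shuffle q^-1 a (e v).
Proof.
move=> q0 v0; elim/e_ind: a => [|k u a IH]; first by rewrite shuffle0l shuffle0r.
rewrite !shuffleE IH !shuffle_e shuffle_words_flip //; congr (_ *: _ + _).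
have -> : pairing v u = 0; first by rewrite /pairing big1.
by rewrite expr0z scale1r.
Qed.

(** * Inverting the generating function of G~ *)

Section ConvolutionInverse.
Variable q : F.
Hypothesis q0 : q != 0.
Variables (D G : nat -> M).
Hypothesis D0 : D 0%N = e [::].
Hypothesis DG : convol q D G =1 delta.

(** [D 0] is the unit, so [X n] is determined by the earlier terms, which vanish by induction. *)
Lemma convol_cancel (X : nat -> M) : (forall n, convol q D X n = 0) -> forall n, X n = 0.
Proof.
move=> DX n; elim/ltn_ind: n => n IH; have := DX n.
rewrite /convol big_ord_recl subn0 D0 shuffle1l big1 ?addr0 // => i _.
by rewrite IH ?shuffle0r //= -subn_gt0 subKn // (leq_trans _ (ltn_ord i)).
Qed.

(** D (G D) = (D G) D = D, and [D] can be cancelled on the left. *)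
Lemma convol_right_inverse : convol q G D =1 delta.
Proof.
move=> n; apply/eqP; rewrite -subr_eq0; apply/eqP; move: n.
apply: convol_cancel => n.
transitivity (convol q D (convol q G D) n - convol q D delta n).
  by rewrite /convol -sumrB; apply: eq_bigr => i _; rewrite linearB.
rewrite -convol_assoc // (eq_convol _ _ DG (frefl D)).
by rewrite convol_delta_l convol_delta_r subrr.
Qed.

Lemma convol_solve_r (A B : nat -> M) : convol q A G =1 B -> A =1 convol q B D.
Proof.
move=> AG n; rewrite -(eq_convol _ _ AG (frefl D)) convol_assoc //.
by rewrite (eq_convol _ _ (frefl A) convol_right_inverse) convol_delta_r.
Qed.

Lemma convol_solve_l (A B : nat -> M) : convol q G A =1 B -> A =1 convol q D B.
Proof.
move=> GA n; rewrite -(eq_convol _ _ (frefl D) GA) -convol_assoc //.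
by rewrite (eq_convol _ _ DG (frefl A)) convol_delta_l.
Qed.

End ConvolutionInverse.

(** * From path sums to C_n *)

Lemma sum_tuple_cons n (f : seq bool -> M) :
  \sum_(t : n.+1.-tuple bool) f t =
  \sum_(t : n.-tuple bool) f (lx :: t) + \sum_(t : n.-tuple bool) f (ly :: t).
Proof.
rewrite (reindex (fun ct : bool * n.-tuple bool => [tuple of ct.1 :: ct.2])) /=.
  by rewrite -(pair_bigA _ (fun c (t : n.-tuple bool) => f (c :: t))) big_bool.
exists (fun t => (thead t, [tuple of behead t])) => [[c t]|t] _.
  by congr (_, _); apply: val_inj.
by rewrite [RHS]tuple_eta.
Qed.

Lemma path_sumE (q : F) s n h :
  path_sum q s n h = \sum_(t : n.-tuple bool) path_weight q s h t *: e t.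
Proof.
elim: n h => [|n IH] h.
  by rewrite (big_pred1 [tuple]) => [|t] /=; [|apply/esym/eqP; apply: tuple0].
rewrite (sum_tuple_cons _ (fun w => path_weight q s h w *: e w)) /= !IH addrC.
by congr (_ + _); rewrite linear_sum scaler_sumr; apply: eq_bigr => t _;
  rewrite linearZ /= prepend_e // scalerA.
Qed.

Definition catalan_elt q n : M :=
  \sum_(t : (n.*2).-tuple bool | catalan t) cweight q t *: e t.

Lemma path_sum_catalan (q : F) s n : q != 0 -> q * q != 1 ->
  path_sum q s n.*2 0 = s ^+ n *: catalan_elt q n.
Proof.
move=> q0 q2; rewrite path_sumE /catalan_elt scaler_sumr [RHS]big_mkcond.
apply: eq_bigr => t _; rewrite path_weight0 //; case: ifP => [ct|_]; last first.
  by rewrite mulr0 scale0r.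
rewrite scalerA; congr (_ ^+ _ * _ *: _).
by move: ct => /andP[_ /eqP]; exact: (count_x_balanced (size_tuple t)).
Qed.

Lemma catalan_elt_inv (q : F) n : catalan_elt q^-1 n = catalan_elt q n.
Proof.
apply: eq_bigr => t _; congr (_ *: _); apply: eq_bigr => i _.
by rewrite /qint !exprz_inv invrK opprK -opprB -[in X in _ / X]opprB invrN mulrNN.
Qed.

Lemma sum_even (f : nat -> M) k : (forall n, odd n -> f n = 0) ->
  \sum_(n < k.*2.+1) f n = \sum_(i < k.+1) f i.*2.
Proof.
move=> f_odd; elim: k => [|k IH]; first by rewrite !big_ord1.
rewrite doubleS big_ord_recr [in RHS]big_ord_recr /= -IH big_ord_recr /=.
by rewrite [f k.*2.+1]f_odd ?addr0 //= odd_double.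
Qed.

(** Only even lengths occur at height 0, so letters can be counted in pairs. [g] stands for
    concatenation with x on the left or y on the right. *)
Lemma alt_conv_even (q : F) s (g : {linear M -> M}) k : q != 0 -> q * q != 1 ->
  alt_conv q (fun n => g (path_sum q s n 0)) k.*2 =
  convol q (fun n => s ^+ n *: g (catalan_elt q n)) (fun n => e (ends_y n.*2)) k.
Proof.
move=> q0 q2; rewrite /alt_conv /convol.
rewrite (sum_even
  (f := fun n => shuffle q (g (path_sum q s n 0)) (e (ends_y (k.*2 - n))))).
  apply: eq_bigr => i _.
  by rewrite path_sum_catalan // linearZ_LR doubleB.
by move=> n n_odd; rewrite path_sum_odd ?addn0 // linear0 shuffle0l.
Qed.

(** * The four products with G~ *)

Definition Gtilde n := e (ends_y n.*2).

Lemma convol_flip (q : F) (A : nat -> M) n : q != 0 ->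
  convol q Gtilde A n = convol q^-1 A Gtilde n.
Proof.
move=> q0; rewrite /convol (reindex_inj rev_ord_inj) /=; apply: eq_bigr => i _.
rewrite subSS subKn -1?ltnS // shuffle_flip // => c.
by rewrite expo_ends_y odd_double.
Qed.

Lemma inv_neq1 (q : F) : q != 0 -> q * q != 1 -> q^-1 * q^-1 != 1.
Proof. by move=> q0; rewrite -invfM invr_eq1. Qed.

Lemma x_catalan_Gtilde (q : F) (n : nat) : q != 0 -> q * q != 1 ->
  convol q (fun k => (- q) ^+ k *: prepend lx (catalan_elt q k)) Gtilde n =
  e (ends_x n.*2.+1).
Proof.
move=> q0 q2; rewrite -(alt_conv_even (- q) (prepend lx)) // alt_conv_prepend //.
by rewrite odd_double.
Qed.

Lemma catalan_y_Gtilde (q : F) (n : nat) : q != 0 -> q * q != 1 ->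
  convol q (fun k => (- q^-1) ^+ k *: append_y (catalan_elt q k)) Gtilde n =
  e (ends_y n.*2.+1).
Proof.
move=> q0 q2; rewrite -(alt_conv_even (- q^-1) append_y) //.
by apply: (proj2 (alt_conv_append _ _ _ _)); rewrite // odd_double.
Qed.

Lemma Gtilde_x_catalan (q : F) (n : nat) : q != 0 -> q * q != 1 ->
  convol q Gtilde (fun k => (- q^-1) ^+ k *: prepend lx (catalan_elt q k)) n =
  e (ends_x n.*2.+1).
Proof.
move=> q0 q2; rewrite convol_flip // -(@x_catalan_Gtilde q^-1) ?invr_eq0 ?inv_neq1 //.
by apply: eq_bigr => i _; rewrite catalan_elt_inv.
Qed.

Lemma Gtilde_catalan_y (q : F) (n : nat) : q != 0 -> q * q != 1 ->
  convol q Gtilde (fun k => (- q) ^+ k *: append_y (catalan_elt q k)) n =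
  e (ends_y n.*2.+1).
Proof.
move=> q0 q2; rewrite convol_flip // -(@catalan_y_Gtilde q^-1) ?invr_eq0 ?inv_neq1 //.
by apply: eq_bigr => i _; rewrite catalan_elt_inv invrK.
Qed.

(** * Solving for x C_n and C_n y *)

Lemma scale_sign_inv (a b : F) (u v : M) n :
  a * b = 1 -> (- a) ^+ n *: u = v -> u = ((-1) ^+ n * b ^+ n) *: v.
Proof.
move=> ab <-; rewrite scalerA -!exprMn mulN1r mulrNN mulrC ab.
by rewrite expr1n scale1r.
Qed.

Lemma catalan_identities (q : F) (D : nat -> M) : q != 0 -> q * q != 1 ->
  D 0%N = e [::] ->
  (forall n, (0 < n)%N -> \sum_(i < n.+1) shuffle q (D i) (e (Gt (n - i))) = 0) ->
  forall n,
    [/\ prepend lx (catalan_elt q n) = ((-1) ^+ n * q ^ (- (n%:Z))) *: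
          \sum_(i < n.+1) shuffle q (e (Wm i)) (D (n - i)%N),
        prepend lx (catalan_elt q n) = ((-1) ^+ n * q ^ (n%:Z)) *:
          \sum_(i < n.+1) shuffle q (D (n - i)%N) (e (Wm i)),
        append_y (catalan_elt q n) = ((-1) ^+ n * q ^ (- (n%:Z))) *:
          \sum_(i < n.+1) shuffle q (D (n - i)%N) (e (Wp i))
      & append_y (catalan_elt q n) = ((-1) ^+ n * q ^ (n%:Z)) *:
          \sum_(i < n.+1) shuffle q (e (Wp i)) (D (n - i)%N)].
Proof.
move=> q0 q2 D0 DGt n.
have DG : convol q D Gtilde =1 delta.
  case=> [|m]; first by rewrite /convol big_ord1 D0 shuffle1l /delta scale1r.
  rewrite /delta scale0r -[RHS](DGt m.+1) //; apply: eq_bigr => i _.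
  by rewrite Gt_ends_y.
have solve_r := convol_solve_r q0 D0 DG; have solve_l := convol_solve_l q0 DG.
have qV : q^-1 * q = 1 by rewrite mulVf.
have qV' : q * q^-1 = 1 by rewrite mulfV.
(* In two of the identities the summation index is that of the right factor W. *)
have convol_rev A B : convol q A B n = \sum_(i < n.+1) shuffle q (A (n - i)%N) (B i).
  rewrite /convol (reindex_inj rev_ord_inj) /=; apply: eq_bigr => i _.
  by rewrite subSS subKn // -ltnS.
rewrite -exprnN -exprnP -exprVn; split.
- apply: (scale_sign_inv qV').
  rewrite (solve_r _ _ (fun k => x_catalan_Gtilde k q0 q2)).
  by apply: eq_bigr => i _; rewrite Wm_ends_x.
- apply: (scale_sign_inv qV).
  rewrite (solve_l _ _ (fun k => Gtilde_x_catalan k q0 q2)) convol_rev.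
  by apply: eq_bigr => i _; rewrite Wm_ends_x.
- apply: (scale_sign_inv qV').
  rewrite (solve_l _ _ (fun k => Gtilde_catalan_y k q0 q2)) convol_rev.
  by apply: eq_bigr => i _; rewrite Wp_ends_y.
- apply: (scale_sign_inv qV).
  rewrite (solve_r _ _ (fun k => catalan_y_Gtilde k q0 q2)).
  by apply: eq_bigr => i _; rewrite Wp_ends_y.
Qed.

End FreeModuleOnWords.

(** * Transfer to the concrete free algebra *)

Section Transfer.
Variables (F : fieldType) (q : F).

Definition lin_map (g : seq bool -> V F) : {linear V F -> V F} := lin g.

Lemma qsh_shuffle_words u v : qsh q u v = shuffle_words (wd F) lin_map q u v.
Proof.
elim: u v => [//|c u IHu]; elim=> [//|d v IHv].
rewrite [LHS]/= [RHS]/= -/(qsh q (c :: u)) -/(shuffle_words (wd F) lin_map q (c :: u)).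
by rewrite IHu IHv /lcat /vcat !bilinE !lin_wd.
Qed.

Lemma star_shuffle a b : star q a b = shuffle (wd F) lin_map q a b.
Proof.
rewrite /star bilinE; apply: eq_lin => u; apply: eq_lin => v; exact: qsh_shuffle_words.
Qed.

Lemma vcat_prepend a c : vcat (wd F [:: c]) a = prepend (wd F) lin_map c a.
Proof. by rewrite /vcat bilinE lin_wd. Qed.

Lemma vcat_append_y a : vcat a (wd F [:: ly]) = append_y (wd F) lin_map a.
Proof. by rewrite /vcat bilinE; apply: eq_lin => u; rewrite lin_wd. Qed.

End Transfer.

Theorem theorem11p3 (F : fieldType) (q : F)
  (hq0 : q != 0) (hqroot : forall k : nat, (0 < k)%N -> q ^+ k != 1)
  (D : nat -> V F)
  (hD0 : D 0%N = wd F [::])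
  (hD : forall n : nat, (0 < n)%N ->
          \sum_(i < n.+1) star q (D i) (wd F (Gt (n - i))) = 0) :
  forall n : nat,
    [/\ vcat (wd F [:: lx]) (Cn q n)
          = ((-1) ^+ n * q ^ (- (n%:Z))) *: \sum_(i < n.+1) star q (wd F (Wm i)) (D (n - i)%N),
        vcat (wd F [:: lx]) (Cn q n)
          = ((-1) ^+ n * q ^ (n%:Z)) *: \sum_(i < n.+1) star q (D (n - i)%N) (wd F (Wm i)),
        vcat (Cn q n) (wd F [:: ly])
          = ((-1) ^+ n * q ^ (- (n%:Z))) *: \sum_(i < n.+1) star q (D (n - i)%N) (wd F (Wp i))
      & vcat (Cn q n) (wd F [:: ly])
          = ((-1) ^+ n * q ^ (n%:Z)) *: \sum_(i < n.+1) star q (wd F (Wp i)) (D (n - i)%N)].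
Proof.
have q2 : q * q != 1 by rewrite -expr2 hqroot.
have hD' n : (0 < n)%N ->
    \sum_(i < n.+1) shuffle (wd F) (@lin_map F) q (D i) (wd F (Gt (n - i))) = 0.
  by move=> n0; rewrite -[RHS](hD n n0); apply: eq_bigr => i _; rewrite star_shuffle.
move=> n; have [E1 E2 E3 E4] :=
  catalan_identities (@lin_wd F) (@V_ind F) hq0 q2 hD0 hD' n.
rewrite vcat_prepend vcat_append_y; split; [move: E1|move: E2|move: E3|move: E4] => E;
  apply: (etrans E); congr (_ *: _); apply: eq_bigr => i _; exact/esym/star_shuffle.
Qed.
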